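(* Let $\mathcal{H}$ and $\mathcal{G}$ be real Hilbert spaces, let $f\in\Gamma_0(\mathcal{H})$, let $L\colon\mathcal{H}\to\mathcal{G}$ be a bounded linear operator such that $$0\in\operatorname{sri}(\operatorname{dom}f^*-\operatorname{ran}L^* ),$$ and let $U\colon\mathcal{G}\to\mathcal{G}$ be a strongly monotone self-adjoint bounded linear operator. Then the following hold: (i) $\operatorname{dom}\,\mathrm{prox}^U_{f,L}=\mathcal{G}$. (ii) $\mathrm{prox}^{U^{-1}}_{f^*\circ L^*}=\mathrm{Id}-UL\,\mathrm{prox}^U_{f,L}U^{-1}$. (iii) $L\rhd f=(f^*\circ L^* )^*\in\Gamma_0(\mathcal{G})$ and $\mathrm{prox}^U_{L\rhd f}=L\,\mathrm{prox}^U_{f,L}$.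
   Context: $\Gamma_0(\mathcal{H})$ is the class of proper lower semicontinuous convex functions $f\colon\mathcal{H}\to\,]-\infty,+\infty]$; $\operatorname{dom}f=\{x : f(x)<+\infty\}$; the Fenchel conjugate is $f^*(u)=\sup_{x\in\mathcal{H}}(\langle x\mid u\rangle-f(x))$. For a nonempty convex set $C\subset\mathcal{H}$, the strong relative interior is $\operatorname{sri}C=\{x\in C : \operatorname{cone}(C-x)=\overline{\operatorname{span}}(C-x)\}$, where $\operatorname{cone}$ denotes the conical hull (for $D$, $\operatorname{cone}D=\bigcup_{\lambda>0}\lambda D$) and $\overline{\operatorname{span}}$ the closed linear span. The infimal postcomposition of $f$ by $L$ is $L\rhd f\colon\mathcal{G}\to[-\infty,+\infty]$, $(L\rhd f)(u)=\inf\{f(x) : x\in\mathcal{H},\ Lx=u\}$ (with $\inf\varnothing=+\infty$). A linear operator $V$ is strongly monotone if there is $\alpha>0$ with $\langle x\mid Vx\rangle\ge\alpha\|x\|^2$ for all $x$; for a strongly monotone self-adjoint bounded linear $V$, $\|x\|_V=\sqrt{\langle x\mid Vx\rangle}$. For $g\in\Gamma_0(\mathcal{G})$ and such $V$ on $\mathcal{G}$, $\mathrm{prox}^V_g(u)$ is the unique minimizer over $y\in\mathcal{G}$ of $g(y)+\frac12\|u-y\|_V^2$. The generalized proximity operator is the set-valued operator $$\mathrm{prox}^U_{f,L}\colon\mathcal{G}\to2^{\mathcal{H}}\colon u\mapsto\arg\min_{x\in\mathcal{H}}\left(f(x)+\tfrac12\|Lx-u\|_U^2\right),$$ with $\operatorname{dom}\,\mathrm{prox}^U_{f,L}=\{u\in\mathcal{G}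 : \mathrm{prox}^U_{f,L}u\neq\varnothing\}$. Compositions and sums with set-valued operators are taken setwise, e.g. $(L\,\mathrm{prox}^U_{f,L})u=\{Lx : x\in\mathrm{prox}^U_{f,L}u\}$; operators with singleton values are identified with maps. $L^*$ is the adjoint of $L$ and $\mathrm{Id}$ the identity. *)

(* Defs.v *)
From HB Require Import structures.
From mathcomp Require Import all_boot all_order all_algebra.
From mathcomp Require Import all_classical all_reals all_analysis.
Set Implicit Arguments.
Unset Strict Implicit.
Unset Printing Implicit Defensive.
Import Order.TTheory GRing.Theory Num.Theory.
Import numFieldNormedType.Exports.

Local Open Scope classical_set_scope.
Local Open Scope ring_scope.

(** Real Hilbert spaces: complete normed spaces whose norm is induced by a
    real inner product. *)
HB.mixin Record isHilbert (R : realType) H of CompleteNormedModule R H := {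
  inner : {dot H for (@idfun R)} ;
  inner_norm : forall x : H, inner x x = `|x| ^+ 2
}.

#[short(type="hilbertType")]
HB.structure Definition Hilbert (R : realType) :=
  {H of isHilbert R H & CompleteNormedModule R H}.

Notation "''[' x , y ]" := (inner x y) : ring_scope.

Section Operators.
Context {R : realType} {H G : hilbertType R}.

(** The adjoint is the map characterized by '[L y, u] = '[y, adjoint L u]; such
    a vector exists (Riesz) and is unique when L is linear and bounded. *)
Definition adjoint (L : H -> G) (u : G) : H :=
  xget 0 [set x | forall y, '[L y, u] = '[y, x]].

Definition bounded_operator (L : {linear H -> G}) : Prop :=
  bounded_near L (nbhs 0).

End Operators.

Section Metric.
Context {R : realType} {G : hilbertType R}.

Definition self_adjoint (V : G -> G) : Prop := adjoint V = V.

Definition strongly_monotone (V : G -> G) : Prop :=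
  exists2 a : R, 0 < a & forall x, a * `|x| ^+ 2 <= '[x, V x].

(** Two-sided inverse of V when V is bijective, in particular (Lax-Milgram) when
    V is linear, bounded and strongly monotone; the value 0 is used outside the
    range of V. *)
Definition inverse (V : G -> G) : G -> G := 'pinv_(fun=> 0) setT V.

Definition metric_norm (V : G -> G) (x : G) : R := Num.sqrt '[x, V x].

End Metric.

Section Sets.
Context {R : realType} {H : hilbertType R}.
Implicit Types C D : set H.

Definition cone D : set H :=
  [set v | exists2 t : R, 0 < t & exists2 x, D x & v = t *: x].

Definition lspan D : set H :=
  [set v | exists n (a : 'I_n -> R) (x : 'I_n -> H),
     (forall i, D (x i)) /\ v = \sum_(i < n) a i *: x i].

Definition setB_mink C D : set H := [set x - y | x in C & y in D].

Definition sri C : set H :=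
  [set x | C x /\
     cone [set y - x | y in C] = closure (lspan [set y - x | y in C])].

End Sets.

Section Functions.
Context {R : realType} {H : hilbertType R}.
Implicit Types f : H -> \bar R.
Local Open Scope ereal_scope.

Definition edom f : set H := [set x | f x < +oo].

Definition eproper f : Prop := (forall x, f x != -oo) /\ edom f !=set0.

(** The inequality is meaningful because this is only used for functions that
    do not take the value -oo. *)
Definition econvex f : Prop :=
  forall (x y : H) (t : R), (0 < t < 1)%R ->
    f (t *: x + (1 - t) *: y)%R <= t%:E * f x + (1 - t)%:E * f y.

Definition Gamma0 : set (H -> \bar R) :=
  [set f | [/\ eproper f, lower_semicontinuous f & econvex f]].

Definition conjugate f (u : H) : \bar R :=
  ereal_sup [set '[x, u]%:E - f x | x in setT].

Definition argmin f : set H := [set x | forall y, f x <= f y].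

(** The set-valued operator attached to the map "unique minimizer": its value is
    that singleton if there is exactly one minimizer, and is empty otherwise. *)
Definition prox (V : H -> H) f (u : H) : set H :=
  [set p | argmin (fun y => f y + (2^-1 * metric_norm V (u - y) ^+ 2)%R%:E)
           = [set p]].

End Functions.

Section Generalized.
Context {R : realType} {H G : hilbertType R}.
Local Open Scope ereal_scope.

Definition inf_postcomp (L : H -> G) (f : H -> \bar R) (u : G) : \bar R :=
  ereal_inf [set f x | x in [set x | L x = u]].

Definition gprox (U : G -> G) (f : H -> \bar R) (L : H -> G) (u : G) : set H :=
  argmin (fun x => f x + (2^-1 * metric_norm U (L x - u) ^+ 2)%R%:E).

Definition setop_dom (A : G -> set H) : set G := [set u | A u !=set0].

End Generalized.

(* Main.v *)
Require Import Defs.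
From mathcomp Require Import all_boot all_order all_algebra.
From mathcomp Require Import all_classical all_reals all_analysis.
From mathcomp Require Import ring lra.
Import Order.TTheory GRing.Theory Num.Theory.
Import numFieldNormedType.Exports.
Local Open Scope classical_set_scope.
Local Open Scope ring_scope.

(** Write h for the infimal postcomposition of f by L. Everything follows from
    two facts: the infimum defining h is attained and h is in [Gamma0]. Indeed
    [conjugate h = conjugate f \o adjoint L] is then immediate, so that
    Fenchel-Moreau applied to h gives the formula for h. Attainment turns the
    minimization over x of f x + |L x - u|^2 / 2 into the minimization over y
    of h y + |y - u|^2 / 2, whose unique solution is the proximal point of h;
    and the proximal point q of h at w = U^-1 u is characterized by U (w - q)
    being a subgradient of h at q. Passing to the conjugate exchanges the roles
    of q and U (w - q), which is Moreau's decomposition.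

    Both facts about h are contained in [exact_level]: if for every e > 0 some x
    has f x <= c + e and |L x - u| <= e, then some x has f x <= c and L x = u.
    This is where the qualification condition enters. Let S be the closed span
    of dom f^* - ran L^*. Both f and L are unchanged when x is replaced by its
    projection on S, so approximate solutions z n may be taken in S. The
    condition says that every s in S is a positive multiple of some y - L^* v
    with f^* y finite; Fenchel's inequality bounds <z n, y> - <L z n, v>, hence
    <z n, s>, from above independently of n. By Banach-Steinhaus the z n are
    bounded.

    Boundedness is exploited without weak topologies: decreasing closed convex
    sets that contain points of bounded norm have a common point
    ([nested_closed_convex]), because nearly minimal-norm points form a Cauchy
    sequence. The same lemma shows that a coercive lower semicontinuous convex
    function has a minimizer, which yields proximal points, and from these the
    Riesz and Lax-Milgram theorems (a linear function), orthogonal projections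
    (an indicator function) and Fenchel-Moreau (proximal points for large
    multiples of the metric) all follow. *)

(** * Inner products and nested convex sets *)

Section InnerProduct.
Context {R : realType} {H : hilbertType R}.
Implicit Types (x y z : H) (a : R).

Lemma innerC x y : '[x, y] = '[y, x].
Proof. have := @hermC _ false _ _ (@inner R H) x y; by rewrite /= expr0 mul1r. Qed.

Lemma innerDl x y z : '[x + y, z] = '[x, z] + '[y, z].
Proof. exact: linearDl. Qed.

Lemma innerDr x y z : '[z, x + y] = '[z, x] + '[z, y].
Proof. exact: linearDr. Qed.

Lemma innerBl x y z : '[x - y, z] = '[x, z] - '[y, z].
Proof. exact: linearBl. Qed.

Lemma innerBr x y z : '[z, x - y] = '[z, x] - '[z, y].
Proof. exact: linearBr. Qed.

Lemma innerZl a x z : '[a *: x, z] = a * '[x, z].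
Proof. exact: linearZl_LR. Qed.

Lemma innerZr a x z : '[x, a *: z] = a * '[x, z].
Proof. exact: linearZr_LR. Qed.

Lemma innerNr x z : '[x, - z] = - '[x, z].
Proof. exact: linearNr. Qed.

Lemma inner0r x : '[x, 0] = 0.
Proof. exact: linear0r. Qed.

Lemma inner_ge0 x : 0 <= '[x, x].
Proof. by rewrite inner_norm sqr_ge0. Qed.

Lemma inner_eq0 x : '[x, x] = 0 -> x = 0.
Proof. by rewrite inner_norm => /eqP; rewrite sqrf_eq0 normr_eq0 => /eqP. Qed.

Lemma inner_inj x y : (forall z, '[z, x] = '[z, y]) -> x = y.
Proof.
move=> e; apply/eqP; rewrite -subr_eq0; apply/eqP/inner_eq0.
by rewrite innerBr e subrr.
Qed.

Lemma cauchy_schwarz x y : `|'[x, y]| <= `|x| * `|y|.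
Proof.
have [->|y0] := eqVneq y 0; first by rewrite inner0r !normr0 mulr0.
have yp : 0 < `|y| ^+ 2 by rewrite exprn_gt0// normr_gt0.
rewrite -(@ler_pXn2r _ 2)// ?nnegrE ?mulr_ge0//.
rewrite -normrX ger0_norm ?sqr_ge0// exprMn.
(* the vector is |y|^2 (x - t y), for the t that minimizes |x - t y| *)
have := inner_ge0 (`|y| ^+ 2 *: x - '[x, y] *: y).
rewrite !(innerBl, innerBr, innerZl, innerZr) !inner_norm (innerC y x).
set a := '[x, y]; set n := _ ^+ 2; set m := _ ^+ 2 => h.
have : 0 <= n * (m * n - a ^+ 2) by apply: le_trans h _; lra.
by rewrite pmulr_rge0// subr_ge0.
Qed.

Lemma parallelogram x y :
  `|x - y| ^+ 2 + `|x + y| ^+ 2 = 2 * (`|x| ^+ 2 + `|y| ^+ 2).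
Proof. by rewrite -!inner_norm !(innerBl, innerBr, innerDl, innerDr); lra. Qed.

Lemma inner_continuous x : continuous (fun y : H => '[x, y]).
Proof.
apply: (@bounded_linear_continuous _ _ _ (inner x)).
apply/linear_boundedP; near=> r => y /=.
apply: le_trans (cauchy_schwarz x y) _; apply: ler_wpM2r; first by [].
by near: r; exact: nbhs_pinfty_ge.
Unshelve. all: by end_near. Qed.

End InnerProduct.

Section Nested.
Context {R : realType} {H : hilbertType R}.

(** This replaces weak compactness of bounded sets. Midpoints enter through the
    parallelogram law, applied to points of nearly minimal norm. *)
Lemma nested_closed_convex (C : nat -> set H) (B : R) :
  (forall n, closed (C n)) ->
  (forall n x y, C n x -> C n y -> C n (2^-1 *: (x + y))) ->
  (forall n m, (n <= m)%N -> C m `<=` C n) ->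
  (forall n, exists2 x, C n x & `|x| <= B) ->
  exists x, forall n, C n x.
Proof.
move=> clC cvC decC bC.
pose N n := [set `|x| ^+ 2 | x in C n].
pose d n := inf (N n).
have N0 n : N n !=set0 by have [x Cx _] := bC n; exists (`|x| ^+ 2), x.
have hN n : has_inf (N n).
  by split => //; exists 0 => _ [x _ <-]; exact: sqr_ge0.
have dlb n x : C n x -> d n <= `|x| ^+ 2.
  by move=> Cx; apply: ge_inf; [exact: (hN n).2|exists x].
(* d n is the squared distance from 0 to C n. It increases to D, so points of
   C M with squared norm below D + t are close to one another once d M is near D. *)
pose D := sup (range d).
have hD : has_sup (range d).
  split; first by exists (d 0%N), 0%N.
  exists (B ^+ 2) => _ [n _ <-]; have [x Cx xB] := bC n.
  apply: (le_trans (dlb n x Cx)); rewrite ler_pXn2r// ?nnegrE//.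
  exact: le_trans xB.
have dD n : d n <= D by apply: ub_le_sup; [exact: hD.2|exists n].
have /choice[p hp] n : exists x, C n x /\ `|x| ^+ 2 < d n + n.+1%:R^-1.
  have [|_ [x Cx <-] xd] := @inf_adherent _ (N n) n.+1%:R^-1 _ (hN n).
    by rewrite invr_gt0.
  by exists x.
have cp : cvg (p @ \oo).
  apply: cauchy_cvg; apply/cauchy_exP => e e0 /=.
  pose t := e ^+ 2 / 16.
  have t0 : 0 < t by rewrite divr_gt0 ?exprn_gt0.
  have [_ [M _ <-] dM] := sup_adherent t0 hD.
  have [K _ hK] : \forall n \near \oo, n.+1%:R^-1 < t.
    by have := @near_infty_natSinv_lt R (PosNum t0).
  exists (p (maxn M K)); exists (maxn M K) => // n /= Mn.
  rewrite -ball_normE /=.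
  have [m Mm hm] : exists2 m, (maxn M K <= m)%N & p m = p (maxn M K) by exists (maxn M K).
  rewrite -hm.
  have in_M k : (maxn M K <= k)%N -> C M (p k) /\ `|p k| ^+ 2 < D + t.
    rewrite geq_max => /andP[Mk Kk]; split; first exact: decC Mk _ (hp k).1.
    apply: lt_le_trans (hp k).2 _; apply: lerD => //; apply: ltW; exact: hK.
  have [Cn nn] := in_M n Mn; have [Cm nm] := in_M m Mm.
  have := dlb M _ (cvC M _ _ Cm Cn).
  rewrite normrZ exprMn gtr0_norm ?invr_gt0// => hd.
  have pl := parallelogram (p m) (p n).
  rewrite -(@ltr_pXn2r _ 2)// ?nnegrE// ?ltW//.
  have -> : e ^+ 2 = 16 * t by rewrite /t; field.
  have := dM; rewrite -/D => dM'.
  have h4 : (2^-1 : R) ^+ 2 = 4^-1 by field.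
  rewrite h4 in hd.
  lra.
exists (lim (p @ \oo)) => n.
apply: (@closed_cvg _ _ \oo _ p (C n)) => //.
exists n => // m /= nm; exact: decC nm _ (hp m).1.
Qed.

End Nested.

(** * Existence of minimizers *)

Section Minimization.
Context {R : realType} {H : hilbertType R}.
Implicit Types (F g : H -> \bar R).

(** The sublevel sets at heights decreasing to the infimum are nested, and
    whatever they have in common is a minimizer. The heights are inf F + 1 / (n + 1), or - n if the infimum is -oo. *)
Lemma argmin_nonempty F :
  (forall c : R, closed [set x | (F x <= c%:E)%E]) ->
  (forall (c : R) x y, (F x <= c%:E)%E -> (F y <= c%:E)%E ->
     (F (2^-1 *: (x + y))%R <= c%:E)%E) ->
  (forall c : R, exists B : R, forall x, (F x <= c%:E)%E -> `|x| <= B) ->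
  edom F !=set0 -> argmin F !=set0.
Proof.
move=> clF cvF bdF [x0 /= Fx0].
pose c (i : \bar R) (n : nat) : R := match i with
  | EFin r => r + n.+1%:R^-1 | _ => - n%:R end.
have c_le i n m : (n <= m)%N -> c i m <= c i n.
  move=> nm; rewrite /c; case: i => [r||].
  - by rewrite lerD2l lef_pV2 ?posrE// ler_nat.
  - by rewrite lerN2 ler_nat.
  - by rewrite lerN2 ler_nat.
have c_inf i y : (i < +oo)%E -> (forall n, (y <= (c i n)%:E)%E) -> (y <= i)%E.
  case: i => [r||] // _ yc.
    apply/lee_addgt0Pr => e e0.
    have [n _ /(_ n (leqnn n)) hn] : \forall n \near \oo, n.+1%:R^-1 < e.
      by have := @near_infty_natSinv_lt R (PosNum e0).
    by apply: le_trans (yc n) _; rewrite -EFinD lee_fin lerD2l ltW.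
  rewrite leeNy_eq; apply/eqP; apply/eq_ninfty => A.
  have [n An] : exists n : nat, - A <= n%:R.
    exists (Num.truncn `|A|).+1; apply/ltW/(le_lt_trans _ (truncnS_gt _)).
    by rewrite -normrN ler_norm.
  by apply: le_trans (yc n) _; rewrite lee_fin lerNl.
have c_gt i n : i = ereal_inf (range F) -> (i < +oo)%E ->
    exists x, (F x <= (c i n)%:E)%E.
  case: i => [r||] // Ei _.
    have [] := @lb_ereal_inf_adherent _ (range F) n.+1%:R^-1.
    - by rewrite invr_gt0.
    - by rewrite -Ei.
    by move=> _ [x _ <-]; rewrite -Ei => /ltW; exists x.
  have [_ [x _ <-] /ltW] := lb_ereal_infNy_adherent (- n%:R) (esym Ei).
  by exists x.
pose i := ereal_inf (range F).
have i_lt : (i < +oo)%E by apply: le_lt_trans Fx0; apply: ereal_inf_lbound; exists x0.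
have {}c_gt n := c_gt i n erefl i_lt.
have [B hB] := bdF (c i 0%N).
have [|||n|x hx] := @nested_closed_convex _ _ (fun n => [set x | (F x <= (c i n)%:E)%E]) B.
- by move=> n; exact: clF.
- by move=> n x y; exact: cvF.
- by move=> n m nm x /= /le_trans; apply; rewrite lee_fin c_le.
- have [x hx] := c_gt n; exists x => //; apply: hB.
  by apply: le_trans hx _; rewrite lee_fin c_le.
exists x => y; apply: (@le_trans _ _ i).
  exact: c_inf.
by apply: ereal_inf_lbound; exists y.
Qed.

Lemma lower_semicontinuousD g (q : H -> R) :
  (forall x, g x != -oo%E) -> lower_semicontinuous g ->
  (forall x a, a < q x -> \forall y \near x, a < q y) ->
  lower_semicontinuous (fun x => g x + (q x)%:E)%E.
Proof.
move=> gN lg lq x a ax.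
have [b bg bq] : exists2 b : R, (b%:E < g x)%E & a - b < q x.
  case Eg : (g x) (gN x) ax => [r||] // _.
    rewrite -EFinD lte_fin => ax; exists ((r + a - q x) / 2); last by lra.
    by rewrite lte_fin; lra.
  move=> _; exists (a - q x + 1); first exact: ltry.
  by lra.
have [V Vx hV] := lg _ _ bg.
exists (V `&` [set y | a - b < q y]); first by apply: filterI => //; exact: lq.
move=> y [/hV bgy /= qy].
case Eg : (g y) (gN y) bgy => [r||] // _.
  by rewrite !lte_fin => ?; lra.
by move=> _; rewrite addye // ltry.
Qed.

Lemma lower_semicontinuous_closed F :
  lower_semicontinuous F <-> forall c : R, closed [set x | (F x <= c%:E)%E].
Proof.
rewrite lower_semicontinuousP; split=> h c; have := h c.
  move=> /open_closedC; congr closed; apply/seteqP; split=> x /=.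
    by move/negP; rewrite -leNgt.
  by rewrite leNgt => /negP.
move=> /closed_openC; congr open; apply/seteqP; split=> x /=.
  by move/negP; rewrite -ltNge.
by rewrite ltNge => /negP.
Qed.

(** Lower semicontinuity bounds g from below near a point x0 of its domain;
    if g fell faster than linearly far away, convexity along the segment to x0
    would violate that bound. Such a
    bound, obtained without a separation theorem, gives coercivity once a
    quadratic term is added. *)
Lemma Gamma0_ge_norm g : Gamma0 g ->
  exists a b : R, 0 <= a /\ forall x, ((b - a * `|x|)%:E <= g x)%E.
Proof.
move=> [[gN [x0 gx0]] lg cg]; rewrite /edom /= in gx0.
case Eg0 : (g x0) (gN x0) gx0 => [r0||] // _ _.
have [|V] := lg x0 (r0 - 1); first by rewrite Eg0 lte_fin; lra.
move=> /nbhs_ballP[d /= d0 dV] hV.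
have [e e0 ed] : exists2 e, 0 < e & e < d by exists (d / 2); lra.
have near_x0 y : `|y - x0| <= e -> ((r0 - 1)%:E < g y)%E.
  move=> ye; apply: hV; apply: dV; rewrite -ball_normE /= distrC.
  exact: le_lt_trans ye ed.
have key x : ((r0 - 1 - e^-1 * `|x - x0|)%:E <= g x)%E.
  have [xe|xe] := leP `|x - x0| e.
    apply: le_trans (ltW (near_x0 x xe)); rewrite lee_fin.
    by rewrite gerBl mulr_ge0// ltW// invr_gt0.
  (* t x + (1 - t) x0 below is the point of the segment at distance e from x0. *)
  pose n := `|x - x0|; have n0 : 0 < n by exact: lt_trans xe.
  pose t := e / n.
  have t01 : (0 < t < 1)%R by rewrite divr_gt0//= ltr_pdivrMr// mul1r.
  have := near_x0 (t *: x + (1 - t) *: x0).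
  have -> : t *: x + (1 - t) *: x0 - x0 = t *: (x - x0).
    by rewrite scalerBl scale1r scalerBr addrA addrAC addrK.
  rewrite normrZ gtr0_norm ?(andP t01).1// -/n /t divfK ?gt_eqF// lexx => /(_ isT) h.
  have := lt_le_trans h (cg x x0 _ t01); rewrite Eg0.
  case Ex : (g x) (gN x) => [r||] // _; last by rewrite leey.
  rewrite -!EFinM -EFinD lte_fin lee_fin -/n -/t => ht.
  have et : e^-1 * n = t^-1 by rewrite /t invf_div mulrC.
  have tr : - 1 < t * (r - r0) by lra.
  have : - t^-1 < r - r0.
    by rewrite -ltr_pdivrMl ?(andP t01).1// in tr; rewrite mulrN1 in tr.
  by rewrite et; lra.
exists e^-1, (r0 - 1 - e^-1 * `|x0|); split; first by rewrite ltW// invr_gt0.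
move=> x; apply: le_trans (key x); rewrite lee_fin.
have ei0 : 0 <= e^-1 by rewrite invr_ge0 ltW.
by have := ler_wpM2l ei0 (ler_normB x x0); lra.
Qed.

End Minimization.

(** * Proximal points in the metric of a symmetric operator *)

Section Symmetric.
Context {R : realType} {H : hilbertType R}.

(** Symmetry on the whole space forces linearity, so a predicate on bare maps
    is enough and covers inverse operators directly. *)
Definition symmetric_op (V : H -> H) : Prop :=
  forall x y, '[V x, y] = '[x, V y].

Variable V : H -> H.
Hypothesis sV : symmetric_op V.

Lemma symmetric_opB x y : V (x - y) = V x - V y.
Proof. by apply: inner_inj => z; rewrite innerBr -!sV innerBr. Qed.

Lemma symmetric_opZ a x : V (a *: x) = a *: V x.
Proof. by apply: inner_inj => z; rewrite innerZr -!sV innerZr. Qed.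

Lemma symmetric_op_sqB x z :
  '[x - z, V (x - z)] = '[x, V x] - 2 * '[x, V z] + '[z, V z].
Proof.
rewrite symmetric_opB innerBl !innerBr (innerC z (V x)) sV; lra.
Qed.

End Symmetric.
Arguments symmetric_op {R H} V.
Arguments symmetric_opB {R H V} sV x y.
Arguments symmetric_opZ {R H V} sV a x.
Arguments symmetric_op_sqB {R H V} sV x z.

Section Prox.
Context {R : realType} {H : hilbertType R}.
Implicit Types (V : H -> H) (g : H -> \bar R).

(** The usual s in the subdifferential of g at p, with finiteness of g p
    recorded by a real witness so that the inequality is one between a real
    and an extended real. *)
Definition subgradient g (p s : H) : Prop :=
  exists2 r : R, g p = r%:E & forall y, ((r + '[y - p, s])%:E <= g y)%E.

Lemma sqr_metric_norm V x : 0 <= '[x, V x] -> metric_norm V x ^+ 2 = '[x, V x].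
Proof. exact: sqr_sqrtr. Qed.

Lemma strongly_monotone_gt0 V x : strongly_monotone V -> x != 0 -> 0 < '[x, V x].
Proof.
move=> [a a0 aV] x0; apply: lt_le_trans (aV x).
by rewrite mulr_gt0// exprn_gt0// normr_gt0.
Qed.

Lemma strongly_monotone_ge0 V x : strongly_monotone V -> 0 <= '[x, V x].
Proof.
move=> [a a0 aV]; apply: le_trans (aV x).
by rewrite mulr_ge0// ?ltW// sqr_ge0.
Qed.

Lemma econvex_midpoint g (c d : R) x y : econvex g ->
  (g x <= c%:E)%E -> (g y <= d%:E)%E ->
  (g (2^-1 *: (x + y)) <= (2^-1 * (c + d))%:E)%E.
Proof.
move=> cg gx gy; have t01 : (0 < (2^-1 : R) < 1)%R by apply/andP; split; lra.
have e : 1 - 2^-1 = 2^-1 :> R by lra.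
have := cg x y _ t01; rewrite e -scalerDr => /le_trans; apply.
rewrite mulrDr EFinD !EFinM; 
apply: leeD; (rewrite lee_pmul2l//; by rewrite lte_fin invr_gt0).
Qed.

(** A strongly monotone quadratic term dominates the at most linear decrease of
    g, so sublevel sets are bounded. *)
Lemma argmin_prox_nonempty V g u : Gamma0 g -> symmetric_op V ->
  strongly_monotone V ->
  argmin (fun y => g y + (2^-1 * metric_norm V (u - y) ^+ 2)%:E)%E !=set0.
Proof.
move=> hg sV mV; have [[gN [x0 gx0]] lg cg] := hg.
have qE y : 2^-1 * metric_norm V (u - y) ^+ 2 = 2^-1 * '[u - y, V (u - y)].
  by rewrite sqr_metric_norm//; exact: strongly_monotone_ge0.
have split_le (c : R) y : (g y + (2^-1 * metric_norm V (u - y) ^+ 2)%:E <= c%:E)%E ->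
    (g y <= (c - 2^-1 * '[u - y, V (u - y)])%:E)%E.
  by rewrite qE EFinB leeBrDr.
apply: argmin_nonempty.
- apply/lower_semicontinuous_closed; apply: lower_semicontinuousD => // x a.
  rewrite qE => ax.
  (* the quadratic form lies above its tangent at x, which is continuous *)
  pose l y := 2^-1 * '[u - x, V (u - x)] + '[V (u - x), x] - '[V (u - x), y].
  have lq y : l y <= 2^-1 * metric_norm V (u - y) ^+ 2.
    rewrite qE /l.
    have := strongly_monotone_ge0 V ((u - y) - (u - x)) mV.
    rewrite (symmetric_op_sqB sV) => h.
    have : '[V (u - x), x] - '[V (u - x), y] = '[V (u - x), (u - y) - (u - x)].
      by rewrite -innerBr; congr (inner _ _); rewrite opprB [RHS]addrC addrA subrK.
    by rewrite innerBr !(innerC (V (u - x)) (u - _)); lra.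
  have cl : continuous l.
    by move=> y; apply: cvgB; [exact: cvg_cst|exact: inner_continuous].
  have lx : a < l x by rewrite /l addrK.
  near=> y; apply: lt_le_trans (lq y); near: y.
  exact: (cvgr_gt (l x) (cl x) a lx).
- move=> c x y /split_le gx /split_le gy.
  rewrite qE -leeBrDr// -EFinB.
  apply: le_trans (econvex_midpoint _ _ _ _ _ cg gx gy) _; rewrite lee_fin.
  have := strongly_monotone_ge0 V ((u - x) - (u - y)) mV.
  rewrite (symmetric_op_sqB sV).
  have -> : u - 2^-1 *: (x + y) = 2^-1 *: ((u - x) - (-1) *: (u - y)).
    rewrite scaleN1r opprK addrACA -opprD scalerBr -[u + u]mulr2n.
    by rewrite -(scaler_nat 2 u) scalerA mulVf ?pnatr_eq0// scale1r.
  rewrite (symmetric_opZ sV) innerZl innerZr (symmetric_op_sqB sV (u - x) (-1 *: (u - y))).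
  by rewrite !(symmetric_opZ sV, innerZl, innerZr); lra.
- move=> c; have [a [b [a0 hab]]] := Gamma0_ge_norm _ hg.
  have [m m0 hm] := mV.
  pose K := c - b + a * `|u|.
  exists (`|u| + 1 + 2 * (`|K| + a) / m) => y /split_le gy.
  have := le_trans (hab y) gy; rewrite lee_fin => h1.
  have h2 := hm (u - y).
  set s := `|u - y| in h2.
  have ys : `|y| <= `|u| + s.
    by have := ler_normB u (u - y); rewrite opprB addrC subrK.
  apply: (le_trans ys); rewrite -addrA lerD2l.
  have [s1|s1] := leP s 1.
    by rewrite ler_wpDr// mulr_ge0 ?invr_ge0 ?mulr_ge0 ?addr_ge0// ltW.
  apply: ler_wpDl => //; rewrite ler_pdivlMr//.
  have kK := ler_norm K.
  have ay : a * `|y| <= a * (`|u| + s) by rewrite ler_wpM2l.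
  have h3 : m * s ^+ 2 <= 2 * (K + a * s) by rewrite /K; lra.
  have s0 : 0 < s by lra.
  rewrite -(ler_pM2r s0).
  have : `|K| <= `|K| * s by rewrite ler_peMr// ltW.
  by rewrite expr2 in h3; lra.
- exists x0; rewrite /edom /= in gx0 *.
  by case: (g x0) gx0 => //= r _; rewrite -EFinD ltry.
Unshelve. all: by end_near. Qed.

(** First-order optimality: comparing the minimizer p with t y + (1 - t) p and
    letting t tend to 0 leaves the subgradient inequality. *)
Lemma prox_exists V g u : Gamma0 g -> symmetric_op V -> strongly_monotone V ->
  exists p, subgradient g p (V (u - p)).
Proof.
move=> hg sV mV; have [p hp] := argmin_prox_nonempty V g u hg sV mV.
have [[gN [x0 gx0]] lg cg] := hg; exists p.
have qE y : 2^-1 * metric_norm V (u - y) ^+ 2 = 2^-1 * '[u - y, V (u - y)].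
  by rewrite sqr_metric_norm//; exact: strongly_monotone_ge0.
have [r gp] : exists r, g p = r%:E.
  rewrite /edom /= in gx0; have := hp x0.
  case: (g x0) (gN x0) gx0 => // r _ _.
  by case: (g p) (gN p) => // r' _ _; exists r'.
exists r => // y.
case gy : (g y) (gN y) => [s||] // _; last by rewrite leey.
rewrite lee_fin.
set d := '[y - p, _]; pose e := '[y - p, V (y - p)].
have key (t : R) : 0 < t < 1 -> r + d - s <= t * (2^-1 * e).
  move=> t01; have := hp (t *: y + (1 - t) *: p).
  have := cg y p t t01; rewrite gp gy -!EFinM -EFinD.
  case Ez : (g _) (gN (t *: y + (1 - t) *: p)) => [z||] // _.
  rewrite !qE lee_fin -!EFinD lee_fin => h1.
  have -> : u - (t *: y + (1 - t) *: p) = (u - p) - t *: (y - p).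
    by rewrite scalerBl scale1r addrCA -scalerBr opprD addrA.
  rewrite (symmetric_op_sqB sV (u - p) (t *: (y - p))) !(symmetric_opZ sV).
  rewrite !(innerZl, innerZr) -/e.
  rewrite -(sV (u - p) (y - p)) (innerC _ (y - p)) -/d => h2.
  have t0 := (andP t01).1.
  by rewrite -(ler_pM2l t0); lra.
rewrite -subr_le0 addrC.
rewrite leNgt; apply/negP => h.
have e0 : 0 <= e by exact: strongly_monotone_ge0.
pose D := r + d - s.
have D0 : 0 < D by rewrite /D; lra.
(* this t lies in ]0, 1[ and satisfies t * e / 2 < D, which contradicts key. *)
pose t := D / (D + e + 1).
have De : 0 < D + e + 1 by lra.
have t01 : 0 < t < 1 by rewrite divr_gt0//= ltr_pdivrMr// mul1r; lra.
have := key t t01; rewrite -/D /t mulrAC ler_pdivlMr// ler_pM2l//; lra.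
Qed.

(** Expanding the square around p, the subgradient inequality makes the
    objective at y exceed the one at p by half the square of the V-norm of
    y - p. This also gives uniqueness. *)
Lemma argmin_subgradient V g u p : symmetric_op V ->
  (forall x, x != 0 -> 0 < '[x, V x]) ->
  subgradient g p (V (u - p)) ->
  argmin (fun y => g y + (2^-1 * metric_norm V (u - y) ^+ 2)%:E)%E = [set p].
Proof.
move=> sV pV [r gp hp].
have qE y : metric_norm V y ^+ 2 = '[y, V y].
  apply: sqr_metric_norm; have [->|/pV/ltW//] := eqVneq y 0.
  by rewrite innerC inner0r.
have grow y : ((r + 2^-1 * metric_norm V (u - p) ^+ 2 +
      2^-1 * '[y - p, V (y - p)])%:E <=
    g y + (2^-1 * metric_norm V (u - y) ^+ 2)%:E)%E.
  have := hp y; case: (g y) => [s||] //; last by move=> _; rewrite leey.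
  rewrite lee_fin -EFinD lee_fin !qE => h.
  have -> : u - y = (u - p) - (y - p) by rewrite opprB addrA subrK.
  rewrite (symmetric_op_sqB sV (u - p) (y - p)) -(sV (u - p) (y - p)).
  by rewrite (innerC _ (y - p)); lra.
apply/seteqP; split=> [q /= hq|_ -> y /=].
  apply/eqP; rewrite -subr_eq0; apply/negP => /negP/pV qp.
  have := le_trans (grow q) (hq p); rewrite gp -EFinD lee_fin; lra.
apply: le_trans (grow y); rewrite gp -EFinD lee_fin lerDl.
have [->|/pV yp] := eqVneq (y - p) 0; first by rewrite innerC inner0r mulr0.
by rewrite mulr_ge0 ?invr_ge0 ?ltW.
Qed.

Lemma set1_set1 (q : H) : [set p | [set q] = [set p]] = [set q].
Proof.
apply/seteqP; split=> p /=; last by move=> ->.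
by move=> /(congr1 (fun A : set H => A p)) /= ->.
Qed.

Lemma prox_subgradient V g u p : symmetric_op V ->
  (forall x, x != 0 -> 0 < '[x, V x]) ->
  subgradient g p (V (u - p)) -> prox V g u = [set p].
Proof. by move=> sV pV sp; rewrite /prox (argmin_subgradient _ _ _ p)// set1_set1. Qed.

End Prox.

(** * Representation, projection and conjugation *)

Section Corollaries.
Context {R : realType} {H : hilbertType R}.

(** Up to sign, the proximal point of l at 0: the only subgradient of a linear
    function is the vector that represents it. *)
Lemma lax_milgram (V : H -> H) (l : H -> R) :
  symmetric_op V -> strongly_monotone V ->
  (forall a x y, l (a *: x + y) = a * l x + l y) -> continuous l ->
  exists p, forall x, l x = '[x, V p].
Proof.
move=> sV mV ll lc.
have lD x y : l (x + y) = l x + l y by have := ll 1 x y; rewrite scale1r mul1r.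
have l0 : l 0 = 0 by have := lD 0 0; rewrite addr0; lra.
have lZ a x : l (a *: x) = a * l x by have := ll a x 0; rewrite !addr0 l0 addr0.
have hl : Gamma0 (EFin \o l).
  split.
  - by split => //; exists 0; rewrite /edom /= ltry.
  - move=> x a; rewrite lte_fin => ax; exists [set y | a < l y].
      exact: (cvgr_gt (l x) (lc x) a ax).
    by move=> y /=; rewrite lte_fin.
  - by move=> x y t _ /=; rewrite lD !lZ -!EFinM -EFinD.
have [p [r /= [<-] hp]] := prox_exists V (EFin \o l) 0 hl sV mV.
have hp' x : '[x, V (- p)] <= l x.
  have := hp (x + p); rewrite /= addrK sub0r lee_fin lD; lra.
exists (- p) => x; apply/eqP; rewrite eq_le hp' andbT.
have := hp' (- x); rewrite -(scaleN1r x) lZ innerZl; lra.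
Qed.

Lemma strongly_monotone_scale (k : R) : 0 < k -> strongly_monotone (fun x : H => k *: x).
Proof. by move=> k0; exists k => // x; rewrite innerZr inner_norm. Qed.

Lemma symmetric_op_scale (k : R) : symmetric_op (fun x : H => k *: x).
Proof. by move=> x y; rewrite innerZl innerZr. Qed.

Lemma riesz (l : H -> R) :
  (forall a x y, l (a *: x + y) = a * l x + l y) -> continuous l ->
  exists p, forall x, l x = '[x, p].
Proof.
move=> ll lc; have [p hp] := lax_milgram _ l (symmetric_op_scale 1)
  (strongly_monotone_scale 1 ltr01) ll lc.
by exists p => x; rewrite hp scale1r.
Qed.

(** The proximal point of the indicator function of S; the subgradient
    inequality on a subspace is orthogonality. *)
Lemma closed_subspace_proj (S : set H) :
  closed S -> S 0 -> (forall a x y, S x -> S y -> S (a *: x + y)) ->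
  forall x, exists p, S p /\ forall y, S y -> '[y, x - p] = 0.
Proof.
move=> clS S0 lS x.
pose g y : \bar R := if y \in S then 0%E else +oo%E.
have gE y : S y -> g y = 0%E by rewrite /g => Sy; rewrite mem_set.
have gN y : ~ S y -> g y = +oo%E by rewrite /g => Sy; rewrite memNset.
have lD y z : S y -> S z -> S (y + z).
  by move=> Sy Sz; have := lS 1 y z Sy Sz; rewrite scale1r.
have lZ a y : S y -> S (a *: y).
  by move=> Sy; have := lS a y 0 Sy S0; rewrite addr0.
have hg : Gamma0 g.
  split.
  - split; first by move=> y; rewrite /g; case: ifP.
    by exists 0; rewrite /edom /= gE// ltry.
  - apply/lower_semicontinuous_closed => c.
    have [c0|c0] := leP 0 c.
      suff -> : [set y | (g y <= c%:E)%E] = S by [].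
      apply/seteqP; split=> y /=; last by move=> Sy; rewrite gE// lee_fin.
      by have [//|Sy] := pselect (S y); rewrite gN.
    suff -> : [set y | (g y <= c%:E)%E] = set0 by exact: closed0.
    apply/seteqP; split=> y //=; rewrite /g; case: ifP => // _.
    by rewrite lee_fin leNgt c0.
  - move=> y z t /andP[t0 t1].
    have [Sy|Sy] := pselect (S y); have [Sz|Sz] := pselect (S z).
    + by rewrite !gE ?mule0 ?adde0//; apply: lD; exact: lZ.
    + by rewrite (gN z)// gt0_muley ?lte_fin ?subr_gt0// (gE y)// mule0 add0e leey.
    + by rewrite (gN y)// gt0_muley// (gE z)// mule0 adde0 leey.
    + by rewrite (gN z)// (gN y)// !gt0_muley ?lte_fin ?subr_gt0// leey.
have [p [r gp hp]] := prox_exists _ g x hg (symmetric_op_scale 1)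
  (strongly_monotone_scale 1 ltr01).
have Sp : S p by apply: contrapT => /gN; rewrite gp.
have r0 : r = 0 by move: gp; rewrite gE// => -[].
have hle y : S y -> '[y, x - p] <= 0.
  move=> Sy; have := hp (y + p); rewrite addrK gE; last exact: lD.
  by rewrite lee_fin r0 add0r scale1r.
exists p; split=> // y Sy; apply/eqP; rewrite eq_le hle//=.
by have := hle _ (lZ (-1) y Sy); rewrite innerZl; lra.
Qed.

End Corollaries.

Section Conjugate.
Context {R : realType} {H : hilbertType R}.
Implicit Types (f : H -> \bar R).

Lemma fenchel_young f x u : ('[x, u]%:E - f x <= conjugate f u)%E.
Proof. by apply: ereal_sup_ubound; exists x. Qed.

Lemma conjugate_le f u c :
  (forall x, ('[x, u]%:E - f x <= c)%E) -> (conjugate f u <= c)%E.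
Proof. by move=> h; apply: ge_ereal_sup => _ [x _ <-]. Qed.

Lemma conjugate_neqNy f u : eproper f -> conjugate f u != -oo%E.
Proof.
move=> [fN [x fx]]; rewrite -ltNye; apply: lt_le_trans (fenchel_young f x u).
rewrite /edom /= in fx; case: (f x) (fN x) fx => // r _ _.
by rewrite -EFinB ltNyr.
Qed.

Lemma subgradient_conjugateE f p s :
  subgradient f p s -> conjugate f s = ('[p, s]%:E - f p)%E.
Proof.
move=> [r fp hp]; apply/eqP; rewrite eq_le fenchel_young andbT.
apply: conjugate_le => x; have := hp x; rewrite fp.
case: (f x) => [t||] //; last by move=> _; rewrite leNye.
by rewrite lee_fin -!EFinB lee_fin innerBl; lra.
Qed.

(** Equality in the Fenchel-Young inequality is symmetric in p and s. *)
Lemma subgradient_conjugate f p s :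
  subgradient f p s -> subgradient (conjugate f) s p.
Proof.
move=> sp; have [r fp hp] := sp; exists ('[p, s] - r).
  by rewrite (subgradient_conjugateE _ _ _ sp) fp.
move=> y; apply: le_trans (fenchel_young f p y).
rewrite fp -EFinB lee_fin innerBl !(innerC _ p); lra.
Qed.

Lemma biconjugate_le f x : eproper f -> (conjugate (conjugate f) x <= f x)%E.
Proof.
move=> pf; apply: conjugate_le => u.
have := fenchel_young f x u; have := conjugate_neqNy f u pf.
case: (f x) (pf.1 x) => [r||] // _; last by rewrite leey.
case: (conjugate f u) => [s||] // _; last by rewrite leNye.
by rewrite -!EFinB !lee_fin innerC; lra.
Qed.

(** Real lower approximants suffice to compare extended reals, which treats
    points inside and outside the domain together in Fenchel-Moreau. *)
Lemma lee_fin_lt (x y : \bar R) :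
  (forall c : R, (c%:E < x)%E -> (c%:E <= y)%E) -> (x <= y)%E.
Proof.
case: y => [s||] h; last 2 first.
- by rewrite leey.
- case: x h => [r||] h //.
  + by have := h (r - 1); rewrite lte_fin => h'; have := h' ltac:(lra); rewrite leeNy_eq.
  + by have := h 0 (ltry _).
case: x h => [r||] h; last by rewrite leNye.
  rewrite lee_fin leNgt; apply/negP => sr.
  have := h ((r + s) / 2); rewrite lte_fin lee_fin => h'.
  have {}h' := h' ltac:(lra); lra.
by move/(_ (s + 1) (ltry _)): h; rewrite lee_fin => ?; exfalso; lra.
Qed.

(** Let p be the proximal point of f at x for the metric k. Equality in
    Fenchel-Young at p gives f** x >= f p + k |x - p|^2. If p is close to x,
    lower semicontinuity bounds f p below by c; if not, the quadratic term
    exceeds c when k is large, since f decreases at most linearly. *)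
Lemma fenchel_moreau f : Gamma0 f -> conjugate (conjugate f) = f.
Proof.
move=> hf; have [pf lf cf] := hf; apply/funext => x.
apply/eqP; rewrite eq_le biconjugate_le//=; apply: lee_fin_lt => c cx.
have [W] := lf _ _ cx; move=> /nbhs_ballP[d /= d0 dW] hW.
have [a [b [a0 hab]]] := Gamma0_ge_norm _ hf.
(* k is chosen so that k n^2 - a n >= K whenever n = |x - p| >= d. *)
pose K := `|c - b + a * `|x| |; pose k := (a + (K / d + 1)) / d.
have K0 : 0 <= K by exact: normr_ge0.
have k0 : 0 < k by rewrite divr_gt0// ltr_wpDl// ltr_wpDl// divr_ge0// ltW.
have [p sp] := prox_exists _ f x hf (symmetric_op_scale k) (strongly_monotone_scale k k0).
have := fenchel_young (conjugate f) (k *: (x - p)) x.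
rewrite (subgradient_conjugateE _ _ _ sp).
have [r fp _] := sp; rewrite fp -!EFinB => /(le_trans _); apply.
rewrite lee_fin (innerC _ x) opprB addrCA -innerBl innerZr inner_norm.
set n := `|x - p|.
have [nd|nd] := ltP n d.
  have : (c%:E < f p)%E by apply/hW/dW; rewrite -ball_normE.
  rewrite fp lte_fin => /ltW cr; apply: ler_wpDr => //.
  by rewrite mulr_ge0 ?sqr_ge0// ltW.
have pn : `|p| <= `|x| + n.
  by have := ler_normB x (x - p); rewrite opprB addrC subrK.
have apn : a * `|p| <= a * (`|x| + n) by rewrite ler_wpM2l.
have := hab p; rewrite fp lee_fin => hr.
have Kc : c - b + a * `|x| <= K by exact: ler_norm.
have n0 : 0 < n by exact: lt_le_trans nd.
have h1 : (a + (K / d + 1)) * n <= k * n ^+ 2.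
  have A0 : 0 <= a + (K / d + 1) by rewrite !addr_ge0// divr_ge0// ltW.
  rewrite /k; set A := a + _ in A0 *.
  have -> : A / d * n ^+ 2 = A * n * (n / d) by rewrite expr2; ring.
  by rewrite ler_peMr ?mulr_ge0 ?ler_pdivlMr ?mul1r// ltW.
have h2 : K <= K / d * n.
  by rewrite mulrAC -mulrA ler_peMr// ler_pdivlMr// mul1r.
lra.
Qed.

End Conjugate.

Section Adjoint.
Context {R : realType} {H G : hilbertType R}.

Lemma adjointP (L : {linear H -> G}) : bounded_operator L ->
  forall x u, '[L x, u] = '[x, adjoint L u].
Proof.
move=> bL x u; have Lc := bounded_linear_continuous bL.
suff : [set v | forall y, '[L y, u] = '[y, v]] (adjoint L u) by exact.
apply: xgetPex; apply: riesz => [a y z|y].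
  by rewrite linearP innerDl innerZl.
have -> : (fun y => '[L y, u]) = inner u \o L by apply/funext => z /=; rewrite innerC.
by apply: continuous_comp; [exact: Lc|exact: inner_continuous].
Qed.

End Adjoint.

(** * Infimal postcomposition *)

Section Span.
Context {R : realType} {H : hilbertType R}.
Implicit Types D : set H.

Lemma closure_normP D x :
  closure D x <-> forall e : R, 0 < e -> exists2 y, D y & `|x - y| < e.
Proof.
split=> [clx e e0|h B /nbhs_ballP[e /= e0 eB]].
  have [y [Dy]] := clx _ (nbhsx_ballx x e e0).
  by rewrite -ball_normE /= => xy; exists y.
have [y Dy xy] := h e e0; exists y; split=> //.
by apply: eB; rewrite -ball_normE.
Qed.

Lemma lspan_sub D x : D x -> lspan D x.
Proof.
move=> Dx; exists 1%N, (fun=> 1), (fun=> x); split=> //.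
by rewrite big_ord_recl big_ord0 addr0 scale1r.
Qed.

Lemma lspan0 D : lspan D 0.
Proof.
by exists 0%N, (fun=> 0), (fun=> 0); split=> [[]//|]; rewrite big_ord0.
Qed.

Lemma lspan_linear D (a : R) x y : lspan D x -> lspan D y -> lspan D (a *: x + y).
Proof.
move=> [n [b [X [DX ->]]]] [m [c [Y [DY ->]]]].
exists (n + m)%N,
  (fun i : 'I_(n + m) => match fintype.split i with inl j => a * b j | inr j => c j end),
  (fun i : 'I_(n + m) => match fintype.split i with inl j => X j | inr j => Y j end); split.
  by move=> i; case: (fintype.split i).
rewrite big_split_ord /= scaler_sumr; congr (_ + _); apply: eq_bigr => i _.
  by rewrite (unsplitK (inl i)) scalerA.
by rewrite (unsplitK (inr i)).
Qed.

Lemma closure_lspan_linear D (a : R) x y :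
  closure (lspan D) x -> closure (lspan D) y -> closure (lspan D) (a *: x + y).
Proof.
move=> /closure_normP hx /closure_normP hy; apply/closure_normP => e e0.
have a1 : 0 < `|a| + 1 by rewrite ltr_wpDl.
have [|x' Dx' xx'] := hx (e / 2 / (`|a| + 1)); first by rewrite !divr_gt0.
have [|y' Dy' yy'] := hy (e / 2); first by rewrite divr_gt0.
exists (a *: x' + y'); first exact: lspan_linear.
rewrite opprD addrACA -scalerBr.
apply: le_lt_trans (ler_normD _ _) _; rewrite normrZ [ltRHS]splitr.
apply: ler_ltD yy'; rewrite ltr_pdivlMr// in xx'.
by apply: le_trans (ltW xx'); rewrite mulrC ler_wpM2l// lerDl.
Qed.

End Span.

Section InfimalPostcomposition.
Context {R : realType} {H G : hilbertType R}.
Variables (f : H -> \bar R) (L : {linear H -> G}).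
Hypothesis hf : Gamma0 f.
Hypothesis hL : bounded_operator L.
Hypothesis hsri : sri (setB_mink (edom (conjugate f)) (range (adjoint L))) 0.

Local Notation C := (setB_mink (edom (conjugate f)) (range (adjoint L))).
Local Notation S := (closure (lspan [set y - 0 | y in C])).

Let pf : eproper f. Proof. by case: hf. Qed.

Let S0 : S 0. Proof. exact/subset_closure/lspan0. Qed.

Let Slin (a : R) x y : S x -> S y -> S (a *: x + y).
Proof. exact: closure_lspan_linear. Qed.

Let SD x y : S x -> S y -> S (x + y).
Proof. by move=> Sx Sy; have := Slin 1 x y Sx Sy; rewrite scale1r. Qed.

Let SN x : S x -> S (- x).
Proof. by move=> Sx; have := Slin (-1) x 0 Sx S0; rewrite scaleN1r addr0. Qed.

Let CS y v : edom (conjugate f) y -> S (y - adjoint L v).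
Proof.
move=> fy; apply/subset_closure/lspan_sub.
exists (y - adjoint L v); last by rewrite subr0.
by exists y => //; exists (adjoint L v).
Qed.

(** Since 0 belongs to dom f^* - ran L^*. *)
Lemma adjoint_dom_conjugate : exists v, edom (conjugate f) (adjoint L v).
Proof.
have [y fy [_ [v _ <-]]] := hsri.1.
by move/eqP; rewrite subr_eq0 => /eqP yv; exists v; rewrite -yv.
Qed.

Let adjointB u v : adjoint L (u - v) = adjoint L u - adjoint L v.
Proof.
by apply: inner_inj => x; rewrite innerBr -!(adjointP L hL) innerBr.
Qed.

Let Sadj v : S (adjoint L v).
Proof.
have [v0 fv0] := adjoint_dom_conjugate.
by have := CS _ (v0 - v) fv0; rewrite adjointB opprB addrCA subrr addr0.
Qed.

Let Sdom y : edom (conjugate f) y -> S y.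
Proof. by move=> fy; rewrite -(subrK (adjoint L 0) y); apply: SD (Sadj _); exact: CS. Qed.

(** By Fenchel-Moreau f x is a supremum over dom f^*, and L x is determined by
    its pairings with ran L^*; both sets lie in S. *)
Lemma eq_on_span x x' : (forall s, S s -> '[s, x' - x] = 0) ->
  (f x' <= f x)%E /\ L x' = L x.
Proof.
move=> hx; split; last first.
  apply: inner_inj => v; apply/eqP; rewrite -subr_eq0 -innerBr -linearB.
  by rewrite innerC (adjointP L hL) innerC hx.
rewrite -(fenchel_moreau _ hf); apply: conjugate_le => y.
have [fy|fy] := ltP (conjugate f y) +oo%E; last first.
  by move: fy; rewrite leye_eq => /eqP ->; rewrite /= leNye.
suff -> : '[y, x'] = '[y, x] by exact: fenchel_young.
by apply/eqP; rewrite -subr_eq0 -innerBr; apply/eqP/hx/Sdom.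
Qed.

(** The qualification condition replaces the closed span by the cone, where
    Fenchel-Young applies. *)
Lemma pointwise_bounded_span (z : nat -> H) (c B : R) :
  (forall n, (f (z n) <= c%:E)%E) -> (forall n, `|L (z n)| <= B) ->
  forall s, S s -> exists M : R, forall n, '[z n, s] <= M.
Proof.
move=> fz Lz s; rewrite -hsri.2 => -[t t0 [_ [_ [y fy [_ [v _ <-]] <-] <-]] ->].
have [F yF] : exists F : R, conjugate f y = F%:E.
  have := conjugate_neqNy f y pf.
  rewrite /edom /= in fy; case: (conjugate f y) fy => // F _ _; by exists F.
exists (t * (c + F + B * `|v|)) => n.
rewrite subr0 innerZr; apply: ler_wpM2l; first exact: ltW.
rewrite innerBr -(adjointP L hL).
have h1 : '[z n, y] <= c + F.
  have := fenchel_young f (z n) y; rewrite yF; move: (fz n) (pf.1 (z n)).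
  by case: (f (z n)) => [r||] //; rewrite -EFinB !lee_fin; lra.
have h2 : - '[L (z n), v] <= B * `|v|.
  apply: le_trans (ler_norm _) _; rewrite normrN.
  by apply: le_trans (cauchy_schwarz _ _) _; rewrite ler_wpM2r.
by lra.
Qed.

(** Banach-Steinhaus is applied to functionals on the whole space: for z n in S
    the value at s only depends on the projection of s on S. *)
Lemma bounded_span (z : nat -> H) (c B : R) :
  (forall n, S (z n)) ->
  (forall n, (f (z n) <= c%:E)%E) -> (forall n, `|L (z n)| <= B) ->
  exists M : R, forall n, `|z n| <= M.
Proof.
move=> Sz fz Lz.
have [||M hM] := @Banach_Steinhauss R H R^o (range (fun n => inner (z n) : H -> R^o)) _ _ 1.
- move=> _ [n _ <-]; split.
    move=> r; exists (`|z n| * r) => x xr.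
    by apply: le_trans (cauchy_schwarz _ _) _; rewrite ler_wpM2l.
  by move=> a x y; rewrite innerDr innerZr.
- move=> s.
  have [p [Sp hp]] := closed_subspace_proj _ (@closed_closure _ _) S0 Slin s.
  have [M hM] := pointwise_bounded_span z c B fz Lz p Sp.
  have [M' hM'] := pointwise_bounded_span z c B fz Lz _ (SN _ Sp).
  exists (Num.max M M') => _ [n _ <-].
  have -> : '[z n, s] = '[z n, p].
    by apply/eqP; rewrite -subr_eq0 -innerBr hp.
  rewrite ler_norml lerNl !le_max hM orTb andbT.
  by rewrite -innerNr hM' orbT.
exists M => n; have [->|z0] := eqVneq (z n) 0.
  rewrite normr0; apply: le_trans (hM _ _ 0 _); [|by exists n|by rewrite normr0].
  exact: normr_ge0.
have n0 : 0 < `|z n| by rewrite normr_gt0.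
have := hM _ (ex_intro2 _ _ n I erefl) (`|z n|^-1 *: z n).
rewrite normrZ normfV normr_id mulVf ?gt_eqF// lexx => /(_ isT).
rewrite innerZr inner_norm expr2 mulKf ?gt_eqF// normr_id; exact.
Qed.

(** A joint statement of attainment of the infimum (take L x = u) and of lower
    semicontinuity (let L x tend to u). *)
Lemma exact_level (c : R) (u : G) :
  (forall e : R, 0 < e -> exists2 x, (f x <= (c + e)%:E)%E & `|L x - u| <= e) ->
  exists2 x, L x = u & (f x <= c%:E)%E.
Proof.
move=> hc; have Lc := bounded_linear_continuous hL.
have [_ lf cf] := hf.
pose D (n : nat) := [set x | (f x <= (c + n.+1%:R^-1)%:E)%E] `&`
                    [set x | `|L x - u| <= n.+1%:R^-1].
have e_le n m : (n <= m)%N -> (m.+1%:R^-1 : R) <= n.+1%:R^-1.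
  by move=> nm; rewrite lef_pV2 ?posrE// ler_nat.
have /choice[z hz] n : exists z, S z /\ D n z.
  have [|x fx Lx] := hc n.+1%:R^-1; first by rewrite invr_gt0.
  have [p [Sp hp]] := closed_subspace_proj _ (@closed_closure _ _) S0 Slin x.
  have [s hs|fp Lp] := eq_on_span x p.
    by rewrite -opprB innerNr hp// oppr0.
  exists p; split=> //; split; first exact: le_trans fx.
  by rewrite /= Lp.
have i1 n : (n.+1%:R^-1 : R) <= 1 by rewrite invf_le1// ler1n.
have [||M hM] := bounded_span z (c + 1) (`|u| + 1) (fun n => (hz n).1).
- move=> n; apply: le_trans (hz n).2.1 _; rewrite lee_fin lerD2l; exact: i1.
- move=> n; rewrite -[L _](subrK u) addrC.
  apply: le_trans (ler_normD _ _) _; rewrite lerD2l.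
  by apply: le_trans (hz n).2.2 _; exact: i1.
have [||||x hx] := @nested_closed_convex _ _ D M.
- move=> n; apply: closedI.
    exact: (lower_semicontinuous_closed f).1.
  have -> : [set x | `|L x - u| <= n.+1%:R^-1] =
      (fun x => `|L x - u|) @^-1` [set r | r <= n.+1%:R^-1] by [].
  apply: preimage_closed; last exact: closed_le.
  move=> x _; apply: cvg_norm; apply: cvgB; [exact: Lc|exact: cvg_cst].
- move=> n x y; rewrite /D; set e := n.+1%:R^-1 => -[/= fx Lx] [/= fy Ly]; split => /=.
    have := econvex_midpoint _ _ _ _ _ cf fx fy.
    by move=> /le_trans; apply; rewrite lee_fin; lra.
  have -> : L (2^-1 *: (x + y)) - u = 2^-1 *: ((L x - u) + (L y - u)).
    rewrite linearZ linearD addrACA -opprD scalerBr -[u + u]mulr2n.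
    by rewrite -(scaler_nat 2 u) scalerA mulVf ?pnatr_eq0// scale1r.
  rewrite normrZ gtr0_norm ?invr_gt0//.
  have := ler_normD (L x - u) (L y - u); lra.
- move=> n m nm x [/= fx Lx]; split => /=.
    by apply: le_trans fx _; rewrite lee_fin lerD2l e_le.
  by apply: le_trans Lx _; exact: e_le.
- by move=> n; exists (z n) => //; exact: (hz n).2.
have small (e : R) : 0 < e -> exists n : nat, n.+1%:R^-1 < e.
  move=> e0; have [n _ hn] := near_infty_natSinv_lt (PosNum e0).
  by exists n; exact: hn (leqnn n).
exists x.
  apply/eqP; rewrite -subr_eq0 -normr_le0 leNgt; apply/negP => /small[n hn].
  by have := le_lt_trans (hx n).2 hn; rewrite ltxx.
apply/lee_addgt0Pr => e /small[n hn].
by apply: le_trans (hx n).1 _; rewrite -EFinD lee_fin lerD2l ltW.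
Qed.

Local Notation h := (inf_postcomp L f).

Lemma inf_postcomp_le x : (h (L x) <= f x)%E.
Proof. by apply: ereal_inf_lbound; exists x. Qed.

(** Fenchel-Young for f at L^* v, with v such that f^* (L^* v) is finite, is an
    affine minorant. *)
Lemma inf_postcomp_neqNy u : h u != -oo%E.
Proof.
have [v fv] := adjoint_dom_conjugate.
have [F vF] : exists F : R, conjugate f (adjoint L v) = F%:E.
  have := conjugate_neqNy f (adjoint L v) pf.
  rewrite /edom /= in fv; case: (conjugate f _) fv => // F _ _; by exists F.
rewrite -ltNye; apply: (@lt_le_trans _ _ ('[u, v] - F)%:E); first exact: ltNyr.
apply: le_ereal_inf_tmp => _ [x <- <-].
have := fenchel_young f x (adjoint L v); rewrite vF (adjointP L hL).
case: (f x) (pf.1 x) => [r||] // _; last by rewrite leey.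
by rewrite -EFinB !lee_fin; lra.
Qed.

Lemma inf_postcomp_attained u : (h u < +oo)%E ->
  exists2 x, L x = u & f x = h u.
Proof.
case Eh : (h u) (inf_postcomp_neqNy u) => [c||] // _ _.
have [e e0|x Lx fx] := exact_level c u.
  have [|_ [x Lx <-] hx] :=
      @lb_ereal_inf_adherent _ [set f x | x in [set x | L x = u]] e e0.
    by rewrite -/(h u) Eh.
  rewrite -/(h u) Eh in hx.
  by exists x; [exact: ltW|rewrite Lx subrr normr0 ltW].
exists x => //; apply/eqP; rewrite eq_le fx -Eh -Lx.
exact: inf_postcomp_le.
Qed.

Lemma inf_postcomp_Gamma0 : Gamma0 h.
Proof.
have [[fN [x0 fx0]] lf cf] := hf; split.
- split; first exact: inf_postcomp_neqNy.
  by exists (L x0); apply: le_lt_trans (inf_postcomp_le x0) fx0.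
- apply/lower_semicontinuous_closed => c u /closure_normP hu /=.
  have [e e0|x <- fx] := exact_level c u.
    have [u' /= hu' uu'] := hu e e0.
    have [x Lx fx] := inf_postcomp_attained u' (le_lt_trans hu' (ltry _)).
    exists x; last by rewrite Lx distrC ltW.
    by rewrite fx; apply: le_trans hu' _; rewrite lee_fin lerDl ltW.
  exact: le_trans (inf_postcomp_le x) fx.
- move=> u v t t01; have /andP[t0 t1] := t01.
  have [hu|] := ltP (h u) +oo%E; last first.
    rewrite leye_eq => /eqP ->; rewrite gt0_muley// addye ?leey//.
    case: (h v) (inf_postcomp_neqNy v) => [r||] // _.
    by rewrite gt0_muley ?lte_fin ?subr_gt0.
  have [hv|] := ltP (h v) +oo%E; last first.
    rewrite leye_eq => /eqP ->.
    rewrite [X in (_ + X)%E]gt0_muley ?lte_fin ?subr_gt0// addey ?leey//.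
    by case: (h u) (inf_postcomp_neqNy u) => [r||] // _; rewrite gt0_muley.
  have [x Lx <-] := inf_postcomp_attained u hu.
  have [y Ly <-] := inf_postcomp_attained v hv.
  apply: le_trans (cf x y t t01).
  by rewrite -Lx -Ly -!linearZ -linearD; exact: inf_postcomp_le.
Qed.

Lemma conjugate_inf_postcomp : conjugate h = conjugate f \o adjoint L.
Proof.
apply/funext => v; apply/eqP; rewrite eq_le /=; apply/andP; split.
  apply: conjugate_le => u; have [/inf_postcomp_attained[x <- <-]|] := ltP (h u) +oo%E.
    by rewrite (adjointP L hL); exact: fenchel_young.
  by rewrite leye_eq => /eqP ->; rewrite /= leNye.
apply: conjugate_le => x; apply: le_trans (fenchel_young h (L x) v).
by rewrite (adjointP L hL); apply: leeB => //; exact: inf_postcomp_le.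
Qed.

(** Minimizing over x can be done in two stages, first along the fibres of L.
    Attainment in the first stage makes every minimizer of the second one the
    image of some x. *)
Lemma image_gprox (q : G -> R) :
  L @` argmin (fun x => f x + (q (L x))%:E)%E = argmin (fun y => h y + (q y)%:E)%E.
Proof.
apply/seteqP; split=> [_ [x xmin <-] y|y ymin].
  have [/inf_postcomp_attained[x' <- <-]|] := ltP (h y) +oo%E; last first.
    by rewrite leye_eq => /eqP ->; rewrite addye// leey.
  by apply: le_trans (xmin x'); rewrite leeD2r// inf_postcomp_le.
have [x0 fx0] := pf.2.
have : (h y < +oo)%E.
  have := le_lt_trans (inf_postcomp_le x0) fx0; have := ymin (L x0).
  case: (h (L x0)) (inf_postcomp_neqNy (L x0)) => [r||] // _.
  case: (h y) => [s||]; [by move=> *; exact: ltry| |by []].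
  by rewrite addye// -EFinD leye_eq.
move=> /inf_postcomp_attained[x Lx fx]; exists x => //= x'.
rewrite fx Lx; apply: le_trans (ymin (L x')) _.
by rewrite leeD2r// inf_postcomp_le.
Qed.

End InfimalPostcomposition.

(** * The inverse of a strongly monotone self-adjoint operator *)

Section Inverse.
Context {R : realType} {G : hilbertType R}.
Variable U : {linear G -> G}.
Hypothesis hU : bounded_operator U.
Hypothesis hUadj : self_adjoint U.
Hypothesis hUmon : strongly_monotone U.

Lemma self_adjoint_symmetric : symmetric_op U.
Proof. by move=> x y; rewrite (adjointP U hU) hUadj. Qed.

(** Lax-Milgram for the functional <w, .>. *)
Lemma strongly_monotone_surj w : exists p, U p = w.
Proof.
have [a x y||p hp] := lax_milgram U (inner w) self_adjoint_symmetric hUmon.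
- by rewrite innerDr innerZr.
- exact: inner_continuous.
by exists p; apply: inner_inj => x; rewrite -hp innerC.
Qed.

Lemma strongly_monotone_inj : injective U.
Proof.
move=> x y xy; apply/eqP; rewrite -subr_eq0; apply/negP => /negP.
move=> /(strongly_monotone_gt0 _ _ hUmon).
by rewrite linearB xy subrr inner0r ltxx.
Qed.

Lemma inverseK : cancel (inverse U) U.
Proof.
move=> w; apply: pinvK; have [p <-] := strongly_monotone_surj w.
by rewrite inE; exists p.
Qed.

Lemma inverseKV : cancel U (inverse U).
Proof. by move=> x; apply: strongly_monotone_inj; rewrite inverseK. Qed.

Lemma symmetric_op_inverse : symmetric_op (inverse U).
Proof.
move=> x y; rewrite -{2}(inverseK x) -{1}(inverseK y).
by rewrite self_adjoint_symmetric.
Qed.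

Lemma inverse_gt0 x : x != 0 -> 0 < '[x, inverse U x].
Proof.
move=> x0; rewrite -{1}(inverseK x) self_adjoint_symmetric.
apply: (strongly_monotone_gt0 _ _ hUmon).
by apply: contra_neq x0 => e; rewrite -(inverseK x) e linear0.
Qed.

End Inverse.

(** * Generalized proximity operators *)

Theorem proposition4p2 (R : realType) (H G : hilbertType R)
  (f : H -> \bar R) (L : {linear H -> G}) (U : {linear G -> G})
  (hf : Gamma0 f)
  (hL : bounded_operator L)
  (hsri : sri (setB_mink (edom (conjugate f)) (range (adjoint L))) 0)
  (hU : bounded_operator U) (hUadj : self_adjoint U)
  (hUmon : strongly_monotone U) :
  [/\ setop_dom (gprox U f L) = setT,
      prox (inverse U) (conjugate f \o adjoint L)
        = (fun u => [set u - U (L x) | x in gprox U f L (inverse U u)])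
    & [/\ inf_postcomp L f = conjugate (conjugate f \o adjoint L),
          Gamma0 (inf_postcomp L f)
        & prox U (inf_postcomp L f) = (fun u => L @` gprox U f L u)]].
Proof.
have sU := self_adjoint_symmetric _ hU hUadj.
have pU x := strongly_monotone_gt0 U x hUmon.
set h := inf_postcomp L f.
have hh : Gamma0 h := inf_postcomp_Gamma0 _ _ hf hL hsri.
have hconj : conjugate h = conjugate f \o adjoint L :=
  conjugate_inf_postcomp _ _ hf hL hsri.
have gproxE u : L @` gprox U f L u =
    argmin (fun y => h y + (2^-1 * metric_norm U (u - y) ^+ 2)%:E)%E.
  rewrite -(image_gprox _ _ hf hL hsri (fun y => 2^-1 * metric_norm U (u - y) ^+ 2)).
  congr (_ @` argmin _); apply/funext => x; congr (_ + (_ * _ ^+ 2)%:E)%E.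
  by rewrite /metric_norm -opprB linearN innerNr innerC innerNr opprK innerC.
have prox_ex u : exists2 p, subgradient h p (U (u - p)) & L @` gprox U f L u = [set p].
  have [p hp] := prox_exists _ h u hh sU hUmon; exists p => //.
  by rewrite gproxE; exact: argmin_subgradient.
have proxE u p : L @` gprox U f L u = [set p] -> prox U h u = [set p].
  rewrite gproxE => hp; rewrite /prox hp; exact: set1_set1.
split.
- apply/seteqP; split=> // u _; have [p _ hp] := prox_ex u.
  have [x gx _] : (L @` gprox U f L u) p by rewrite hp.
  by exists x.
- apply/funext => u; have [q hq gq] := prox_ex (inverse U u).
  have -> : [set u - U (L x) | x in gprox U f L (inverse U u)] =
      (fun y => u - U y) @` (L @` gprox U f L (inverse U u)).
    by rewrite image_comp.
  rewrite gq image_set1 -hconj.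
  have Uq : U (inverse U u - q) = u - U q by rewrite linearB inverseK.
  (* u - U q is a subgradient of h at q; the conjugate exchanges the two *)
  apply: prox_subgradient.
  + exact: symmetric_op_inverse.
  + exact: inverse_gt0.
  + rewrite opprB addrCA subrr addr0 inverseKV// -Uq.
    exact: subgradient_conjugate.
- split=> //; first by rewrite -hconj fenchel_moreau.
  by apply/funext => u; have [p _ hp] := prox_ex u; rewrite hp; exact: proxE.
Qed.
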